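(* Let $f:\{0,1\}^n\to\{0,1\}$ be computable by a width-3 read-once branching program with sudden death of length $n$, and let $p=\mathbb{E}[f]$. Then there exists $g:\{0,1\}^n\to\{0,1\}$ that is an intersection (conjunction) of functions each computable by a width-2 read-once branching program of length $n$, such that $g\le f$ pointwise and $\mathbb{E}[g]\ge(p/2)^{13}$.
   Context: A read-once branching program (ROBP) of width $d$ and length $n$ has vertex set partitioned into layers $V_0\cup\cdots\cup V_n$ with $V_0=\{(0,0)\}$ (start state), $V_t=\{(t,i)\}_{i\in[d]}$ for $1\le t\le n-1$, $V_n=\{(n,1),(n,d)\}$ ($(n,1)$ accepts, $(n,d)$ rejects). Each vertex of $V_t$ ($t<n$) has two out-edges labeled $0$ and $1$ into $V_{t+1}$. On input $x\in\{0,1\}^n$, start at $(0,0)$ and from layer $t$ follow the edge labeled $x_{t+1}$; $x$ is accepted iff the path ends at $(n,1)$. A width-$d$ ROBP with sudden death is one in which both out-edges of $(t,d)$ go to $(t+1,d)$ for all $t=1,\ldots,n-1$. $\mathbb{E}$ is under the uniform distribution. *)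

(* Defs.v *)
From mathcomp Require Import all_boot all_order all_algebra.

Set Implicit Arguments.
Unset Strict Implicit.
Unset Printing Implicit Defensive.

Import GRing.Theory Num.Theory.

Local Open Scope nat_scope.

(* The vertex (t, i) is represented by its index i in layer t; the indices   *)
(* 1, ..., d are kept 1-based.  A length n = 0 makes the descriptions of V_0 *)
(* and V_n clash; here V_0 wins, so that such a program accepts nothing.     *)
Definition layer (d n t : nat) : pred nat :=
  if t == 0 then pred1 0
  else if t == n then pred2 1 d
  else [pred i | 1 <= i <= d].

(* Only the values of [edge] at (t, i) with t < n and i in layer t matter.   *)
Record robp (d n : nat) : Type := Robp {
  edge : nat -> nat -> bool -> nat;
  edge_layer : forall t i b,
    t < n -> i \in layer d n t -> edge t i b \in layer d n t.+1
}.

(* The 1-based input bit x_{t+1} is the entry of x at the 0-based index t.   *)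
Fixpoint state_at d n (P : robp d n) (x : n.-tuple bool) (t : nat) : nat :=
  if t is t'.+1 then edge P t' (state_at P x t') (nth false x t') else 0.

Definition accepts d n (P : robp d n) (x : n.-tuple bool) : bool :=
  state_at P x n == 1.

Definition sudden_death d n (P : robp d n) : Prop :=
  forall t b, 1 <= t < n -> edge P t d b = d.

Definition computes d n (P : robp d n) (f : n.-tuple bool -> bool) : Prop :=
  forall x, f x = accepts P x.

Definition robp_computable d n (f : n.-tuple bool -> bool) : Prop :=
  exists P : robp d n, computes P f.

Definition sudden_death_computable d n (f : n.-tuple bool -> bool) : Prop :=
  exists2 P : robp d n, sudden_death P & computes P f.

(* As {0,1}^n has finitely many Boolean functions, finite families suffice.  *)
Definition is_intersection_of n (C : (n.-tuple bool -> bool) -> Prop)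
    (g : n.-tuple bool -> bool) : Prop :=
  exists (m : nat) (h : 'I_m -> n.-tuple bool -> bool),
    (forall i, C (h i)) /\ (forall x, g x = [forall i, h i x]).

Definition expectation n (f : n.-tuple bool -> bool) : rat :=
  ((\sum_(x : n.-tuple bool) (f x)%:R) / #|{: n.-tuple bool}|%:R)%R.

(* Main.v *)
(* Redirect every edge into the dead state to a live one: the resulting run
   has two states, and it coincides with the original run as long as no
   redirected edge is used.  Hence f is itself the intersection, over the
   steps k, of the width-2 tests that the redirected run does not use a
   redirected edge at step k, so g = f works, and (p/2)^13 <= p on [0, 1]. *)
Require Import Defs.
From mathcomp Require Import all_boot all_order all_algebra.

Set Implicit Arguments.
Unset Strict Implicit.
Unset Printing Implicit Defensive.

Import Order.TTheory GRing.Theory Num.Theory.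

Lemma state_at_layer d n (P : robp d n) x t :
  t <= n -> state_at P x t \in layer d n t.
Proof.
elim: t => [|t IHt] lt_tn; first by rewrite /layer /= inE.
exact: edge_layer lt_tn (IHt (ltnW lt_tn)).
Qed.

(** Indices 1 and 2 lie in every layer after the start, the last included. *)
Fact bool_edge_layer n (c : nat -> nat -> bool -> bool) t i b :
  t < n -> i \in layer 2 n t -> (if c t i b then 1 else 2) \in layer 2 n t.+1.
Proof. by rewrite /layer /= => _ _; case: (_ == n); case: (c t i b). Qed.

Definition bool_robp n (c : nat -> nat -> bool -> bool) : robp 2 n :=
  Robp (@bool_edge_layer n c).

(** The dead target 3 is merged into 1 before step [k]; step [k] overwrites the simulated state by
    its verdict, which later steps copy. *)
Definition survival_test n (P : robp 3 n) (k : nat) : robp 2 n :=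
  bool_robp n (fun t i b =>
    if t < k then edge P t i b != 2
    else if t == k then edge P t i b != 3
    else i == 1).

Section SuddenDeath.

Variables (n : nat) (P : robp 3 n).

Lemma state_at_survival_test x k t :
    k < n -> (forall j, j <= k -> state_at P x j != 3) -> t <= k ->
  state_at (survival_test P k) x t = state_at P x t.
Proof.
move=> lt_kn alive; elim: t => [//|t IHt] lt_tk.
have lt_tn := leq_ltn_trans lt_tk lt_kn.
(* Layer [t.+1] is interior, so a live state there is 1 or 2, which the redirection keeps. *)
have := state_at_layer P x (ltnW lt_tn); have := alive _ lt_tk.
rewrite /layer /= (ltn_eqF lt_tn) IHt ?(ltnW lt_tk) // lt_tk inE.
by case: (edge P t _ _) => [|[|[|[|?]]]].
Qed.

Lemma survival_testP x k :
    k < n -> (forall j, j <= k -> state_at P x j != 3) ->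
  accepts (survival_test P k) x = (state_at P x k.+1 != 3).
Proof.
move=> lt_kn alive; rewrite /accepts.
(* Generalized from [n] to all [t > k], so that induction can carry the verdict forward. *)
suff final t : k < t ->
    (state_at (survival_test P k) x t == 1) = (state_at P x k.+1 != 3).
  exact: final.
elim: t => [//|t IHt]; rewrite ltnS leq_eqVlt => /predU1P[<-|lt_kt].
  rewrite /= ltnn eqxx state_at_survival_test //.
  by case: (edge P k _ _ != 3).
rewrite -(IHt lt_kt) [in LHS]/= ltnNge ltnW //= (gtn_eqF lt_kt).
by case: (state_at _ _ t == 1).
Qed.

Hypothesis sdP : sudden_death P.

Lemma accepts_alive x t : accepts P x -> t <= n -> state_at P x t != 3.
Proof.
move=> accx le_tn; apply/eqP => dead_t.
suff dead m : t <= m <= n -> state_at P x m = 3.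
  by move: accx; rewrite /accepts dead ?le_tn ?leqnn.
elim: m => [|m IHm]; first by rewrite leqn0 => /andP[/eqP t0 _]; rewrite t0 in dead_t.
case/andP; rewrite leq_eqVlt => /predU1P[<-//|lt_tm] lt_mn.
rewrite /= IHm ?(ltnW lt_mn) ?andbT // sdP // lt_mn andbT.
(* Sudden death starts at layer 1; [t = 0] is excluded because the start state is 0. *)
by case: t dead_t lt_tm {le_tn IHm} => // t _; case: m {lt_mn}.
Qed.

Lemma accepts_survival_tests x : 0 < n ->
  accepts P x = [forall k : 'I_n, accepts (survival_test P k) x].
Proof.
move=> n_gt0; apply/idP/forallP => [accx k | acc_tests].
  rewrite survival_testP // => [|j le_jk]; apply: accepts_alive => //.
  exact: leq_trans le_jk (ltnW _).
(* Test [t] is faithful only on runs alive up to [t], hence the tests are used in increasing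
   order. *)
have alive t : t <= n -> forall j, j <= t -> state_at P x j != 3.
  elim: t => [_ [|j] //|t IHt lt_tn j].
  have alive_t := IHt (ltnW lt_tn).
  rewrite leq_eqVlt => /predU1P[->|]; last exact: alive_t.
  by rewrite -survival_testP //; have := acc_tests (Ordinal lt_tn).
(* The last layer holds only 1 and 3, so alive means accepted. *)
have := state_at_layer P x (leqnn n); rewrite /layer eqxx gtn_eqF // !inE.
by rewrite (negPf (alive _ (leqnn n) _ (leqnn n))) orbF.
Qed.

End SuddenDeath.

Lemma sudden_death_intersection n (f : n.-tuple bool -> bool) :
  sudden_death_computable 3 f -> is_intersection_of (@robp_computable 2 n) f.
Proof.
case=> P sdP fP; have [n0 | n_gt0] := posnP n.
  (* At length 0 every program accepts nothing, whereas an empty intersection would be constantly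
     true. *)
  exists 1, (fun _ => f); split=> [_ | x].
    exists (bool_robp n (fun _ _ _ => true)) => x.
    by rewrite fP /accepts; move: P x {sdP fP}; rewrite n0.
  by apply/idP/forallP => [// | /(_ ord0)].
exists n, (fun k => accepts (survival_test P k)); split=> [k | x].
  by exists (survival_test P k).
by rewrite fP accepts_survival_tests.
Qed.

Local Open Scope ring_scope.

Lemma expectation_itv n (f : n.-tuple bool -> bool) : 0 <= expectation f <= 1.
Proof.
have card_gt0 : 0 < #|{: n.-tuple bool}|%:R :> rat.
  by rewrite ltr0n card_tuple card_bool expn_gt0.
rewrite /expectation divr_ge0 ?sumr_ge0 ?ler0n //=.
rewrite ler_pdivrMr // mul1r -natr_sum ler_nat -sum1_card.
by apply: leq_sum => x _; apply: leq_b1.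
Qed.

Theorem theorem6p7 (n : nat) (f : n.-tuple bool -> bool) (p : rat)
    (hf : sudden_death_computable 3 f) (hp : p = expectation f) :
  exists g : n.-tuple bool -> bool,
    [/\ is_intersection_of (robp_computable 2 (n := n)) g,
        forall x : n.-tuple bool, (g x <= f x)%N
      & ((p / 2%:R) ^+ 13 <= expectation g)%R].
Proof.
exists f; split=> //; first exact: sudden_death_intersection.
have /andP[p_ge0 p_le1] := expectation_itv f; rewrite hp.
(* The bound passes through [p / 2], whose powers do not exceed it. *)
have half_le : expectation f / 2%:R <= expectation f.
  by rewrite ler_pdivrMr // ler_peMr // ler1n.
apply: le_trans (half_le); apply: ler_iXnr => //; first exact: divr_ge0.
exact: le_trans p_le1.
Qed.
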